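(* Let $G$ be a connected graph, $L$ a constant capacity function (uniform capacities) and $k$ a positive integer. (a) If LP1 for $(G,L,k)$ is feasible, then $G^6$ admits a hard-capacitated $k$-center solution. (b) If soft LP1 for $(G,L,k)$ is feasible, then $G^5$ admits a soft-capacitated $k$-center solution.
   Context: $G=(V,E)$ undirected unweighted, $\mathrm{dist}_G$ shortest-path distance, $L:V\to\mathbb{N}$, $k$ a positive integer. LP1: variables $x_{u,v},y_u$ with (1) $\sum_u y_u=k$; (2) $x_{u,v}\le y_u$; (3) $\sum_v x_{u,v}\le L(u)y_u$; (4) $\sum_u x_{u,v}=1$; (5) $0\le y_u\le1$; (6) $x_{u,v}=0$ if $\mathrm{dist}_G(u,v)>1$; (7) $x_{u,v}\ge0$. Soft LP1 is LP1 with the upper bound $y_u\le 1$ removed. $G^\delta$ is the graph on $V$ with $uv$ an edge iff $\mathrm{dist}_G(u,v)\le\delta$. A hard-capacitated $k$-center solution in a graph $H$ on $V$: a set $S\subseteq V$, $|S|\le k$, and $\phi:V\to S$ with $\phi(v)=v$ or $\phi(v)v\in E(H)$, and $|\phi^{-1}(u)|\le L(u)$. A soft-capacitated $k$-center solution in $H$: $m:V\to\mathbb{Z}_{\ge0}$ with $\sum m(u)\le k$ and $\phi:V\to V$ with $m(\phi(v))\ge1$, $\phi(v)=v$ or $\phi(v)v\in E(H)$, and $|\phi^{-1}(u)|\le L(u)m(u)$. *)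

(* Defs.v *)
From HB Require Import structures.
From mathcomp Require Import all_boot all_order all_algebra.
Set Implicit Arguments. Unset Strict Implicit. Unset Printing Implicit Defensive.
Import Order.TTheory GRing.Theory Num.Theory.

Definition simple_graph (T : finType) (e : rel T) : Prop :=
  symmetric e /\ irreflexive e.

Definition connected_graph (T : finType) (e : rel T) : Prop :=
  forall u v : T, connect e u v.

Definition dist_le (T : finType) (e : rel T) (d : nat) (u v : T) : Prop :=
  exists p : seq T, [/\ (size p <= d)%N, path e u p & last u p = v].

Definition power_edge (T : finType) (e : rel T) (delta : nat) (u v : T) : Prop :=
  u <> v /\ dist_le e delta u v.

Local Open Scope ring_scope.

Definition LP1_sol (R : realFieldType) (T : finType) (e : rel T)
    (L : T -> nat) (k : nat) (x : T -> T -> R) (y : T -> R) : Prop :=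
  [/\ \sum_u y u = k%:R,
      (forall u v, x u v <= y u),
      (forall u, \sum_v x u v <= (L u)%:R * y u),
      (forall v, \sum_u x u v = 1)
    & [/\ (forall u, 0 <= y u /\ y u <= 1),
        (forall u v, ~ dist_le e 1 u v -> x u v = 0)
      & (forall u v, 0 <= x u v)]].                               (* (7) *)

Definition softLP1_sol (R : realFieldType) (T : finType) (e : rel T)
    (L : T -> nat) (k : nat) (x : T -> T -> R) (y : T -> R) : Prop :=
  [/\ \sum_u y u = k%:R,
      (forall u v, x u v <= y u),
      (forall u, \sum_v x u v <= (L u)%:R * y u),
      (forall v, \sum_u x u v = 1)
    & [/\ (forall u, 0 <= y u),
        (forall u v, ~ dist_le e 1 u v -> x u v = 0)
      & (forall u v, 0 <= x u v)]].

Definition LP1_feasible (R : realFieldType) (T : finType) (e : rel T)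
    (L : T -> nat) (k : nat) : Prop :=
  exists (x : T -> T -> R) (y : T -> R), LP1_sol e L k x y.

Definition softLP1_feasible (R : realFieldType) (T : finType) (e : rel T)
    (L : T -> nat) (k : nat) : Prop :=
  exists (x : T -> T -> R) (y : T -> R), softLP1_sol e L k x y.

Local Close Scope ring_scope.

Definition hard_kcenter (T : finType) (H : T -> T -> Prop)
    (L : T -> nat) (k : nat) : Prop :=
  exists (S : {set T}) (phi : T -> T),
    [/\ #|S| <= k,
        (forall v, phi v \in S),
        (forall v, phi v = v \/ H (phi v) v)
      & (forall u, #|[set v | phi v == u]| <= L u)].

Definition soft_kcenter (T : finType) (H : T -> T -> Prop)
    (L : T -> nat) (k : nat) : Prop :=
  exists (m : T -> nat) (phi : T -> T),
    [/\ \sum_u m u <= k,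
        (forall v, 1 <= m (phi v)),
        (forall v, phi v = v \/ H (phi v) v)
      & (forall u, #|[set v | phi v == u]| <= L u * m u)].

(* Main.v *)
Require Import Defs.
From HB Require Import structures.
From mathcomp Require Import all_boot all_order all_algebra.
From mathcomp Require Import zify lra.

Set Implicit Arguments. Unset Strict Implicit. Unset Printing Implicit Defensive.
Import Order.TTheory GRing.Theory Num.Theory.

(** Clusters of radius 2 are grown around "monarchs" whose closed neighbourhoods
    are disjoint, and the monarchs form a tree whose edges have length 3; each
    closed neighbourhood carries opening [y] of total at least 1.  From the
    leaves to the root, every monarch keeps the integral part of the mass of its
    cluster plus the residues of its children, and reserves the fractional part,
    taken from its own closed neighbourhood, for its parent; at the root nothing
    is left.  Each unit of opening thus moves from a closed neighbourhood to the
    parent monarch, that is by at most 4, which is the soft case.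

    In the hard case a monarch [m] opens distinct vertices among its cluster and
    its children with positive residue, and a child residue can reach at
    distance 5 only the neighbours of [m] and the siblings hanging from the same
    neighbour of [m].  Opening first, for each neighbour, as many children as
    the floor of their residues, and next the neighbours of [m], suffices.

    The moved opening dominates [y] in the sense of Hall's condition, and since
    the capacities are uniform this makes Hall's condition hold for the
    assignment of clients, at a distance larger by one. *)

(** * Bounded walks *)

(** A boolean form of [dist_le], usable in set comprehensions and index predicates. A step may stand
    still, so [d] bounds the length of the walk instead of fixing it. *)
Fixpoint within (T : finType) (e : rel T) (d : nat) (u v : T) : bool :=
  if d is d'.+1 then [exists w, ((u == w) || e u w) && within e d' w v]
  else u == v.

Lemma within_step (T : finType) (e : rel T) d u w v :
  (u == w) || e u w -> within e d w v -> within e d.+1 u v.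
Proof. by move=> uw wv; apply/existsP; exists w; rewrite uw. Qed.

Lemma within_refl (T : finType) (e : rel T) d u : within e d u u.
Proof. by elim: d => [|d IH] //=; apply: within_step IH; rewrite eqxx. Qed.

Lemma within_trans (T : finType) (e : rel T) d1 d2 u w v :
  within e d1 u w -> within e d2 w v -> within e (d1 + d2) u v.
Proof.
elim: d1 u => [|d IH] u; first by move/eqP->.
case/existsP=> w' /andP[uw' w'w] wv.
by apply: within_step uw' (IH _ w'w wv).
Qed.

Lemma within_mono (T : finType) (e : rel T) d1 d2 u v :
  d1 <= d2 -> within e d1 u v -> within e d2 u v.
Proof.
by move=> le uv; rewrite -(subnKC le); apply: within_trans uv (within_refl _ _ _).
Qed.

Lemma within_edge (T : finType) (e : rel T) u v : e u v -> within e 1 u v.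
Proof. by move=> uv; apply: (within_step (w := v)); rewrite ?uv ?orbT /=. Qed.

Lemma within_sym (T : finType) (e : rel T) d u v :
  symmetric e -> within e d u v = within e d v u.
Proof.
move=> sym; suff imp a b : within e d a b -> within e d b a by apply/idP/idP; apply: imp.
elim: d a => [|d IH] a /=; first by rewrite eq_sym.
case/existsP=> w /andP[aw wb].
have wa : within e 1 w a by apply: (within_step (w := a)); rewrite /= // eq_sym sym.
by have := within_trans (IH _ wb) wa; rewrite addn1.
Qed.

Lemma withinP (T : finType) (e : rel T) d u v :
  reflect (dist_le e d u v) (within e d u v).
Proof.
apply: (iffP idP) => [|[p []]].
  elim: d u => [|d IH] u /=; first by move/eqP->; exists [::].
  case/existsP=> w /andP[/orP[/eqP<-|uw] /IH[p [sp pp lp]]].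
    by exists p; split=> //; apply: leqW.
  by exists (w :: p); split=> //=; rewrite uw.
elim: p d u => [|w p IH] d u /=; first by move=> _ _ ->; apply: within_refl.
case: d => // d sp /andP[uw pp] lp.
by apply: (within_step (w := w)); rewrite ?uw ?orbT //; apply: IH.
Qed.

(** * Hall's theorem with capacities *)

(** Induction on the size of [X], split on whether some nonempty proper subset is tight, that is,
    meets Hall's condition with equality. The [option] covers vertices outside [X] and an empty
    [T']. *)
Lemma capacitated_hall (T T' : finType) (r : T -> T' -> bool) (c : T' -> nat)
    (X : {set T}) :
  (forall A : {set T}, A \subset X ->
     #|A| <= \sum_(u | [exists v in A, r v u]) c u) ->
  exists phi : T -> option T',
    (forall v, v \in X -> exists2 u, phi v = Some u & r v u) /\
    (forall u, #|[set v in X | phi v == Some u]| <= c u).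
Proof.
move: {2}#|X|.+1 (ltnSn #|X|) => n.
elim: n X c => // n IH X c ltX hall.
case: (set_0Vmem X) => [->|[v0 v0X]].
  exists (fun=> None); split=> [v|u]; first by rewrite inE.
  by rewrite (_ : [set v in set0 | _] = set0) ?cards0 //; apply/setP=> v; rewrite !inE.
pose near (A : {set T}) u := [exists v in A, r v u].
have nearS (A B : {set T}) u : A \subset B -> near A u -> near B u.
  move=> /subsetP AB /exists_inP[v vA rv].
  by apply/exists_inP; exists v => //; apply: AB.
have [/existsP[B /and3P[Bn0 BX /eqP Bt]]|/existsPn slack] :=
  boolP [exists B : {set T}, [&& B != set0, B \proper X &
           #|B| == \sum_(u | near B u) c u]].
  have sBX := proper_sub BX.
  have cB := proper_card BX.
  have [|A AB|f1 [f1r f1c]] := IH B c; first lia.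
    by apply: hall; apply: subset_trans AB sBX.
  have cD := cardsD X B; rewrite (setIidPr sBX) in cD.
  have B0 : 0 < #|B| by rewrite card_gt0.
  (* A tight [B] uses up all the capacity near it, so the rest of [X] has to do without. *)
  have [|A AD|f2 [f2r f2c]] := IH (X :\: B) (fun u => if near B u then 0 else c u).
  - by rewrite cD; lia.
  - have AX : A \subset X by apply: subset_trans AD (subsetDl _ _).
    have dAB : [disjoint A & B].
      by move: AD; rewrite subsetD => /andP[].
    (* Hall's condition for [A] is the one for [A :|: B] minus the equality for [B]. *)
    have /hall : A :|: B \subset X by rewrite subUset AX.
    rewrite cardsU (disjoint_setI0 dAB) cards0 subn0 (bigID (near B)) /= Bt.
    have -> : \sum_(u | [exists v in A :|: B, r v u] && near B u) c u =
              \sum_(u | near B u) c u.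
      apply: eq_bigl => u; apply/andP/idP => [[]//|nB]; split=> //.
      by apply: nearS nB; apply: subsetUr.
    rewrite addnC leq_add2l => /leq_trans; apply.
    rewrite [X in _ <= X](bigID (near B)) /= [X in _ <= X + _]big1 ?add0n; last first.
      by move=> u /andP[_ ->].
    rewrite [X in _ <= X](eq_bigr c) => [|u /andP[_ /negPf->] //].
    rewrite big_mkcond [X in _ <= X]big_mkcond; apply: leq_sum => u _.
    case: ifP => // /andP[/exists_inP[v]]; rewrite inE => /orP[vA|vB] rv nnB.
      rewrite (_ : [exists v0 in A, _]) ?nnB //.
      by apply/exists_inP; exists v.
    by case/negP: nnB; apply/exists_inP; exists v.
  exists (fun v => if v \in B then f1 v else f2 v); split=> [v vX|u].
    case: ifP => vB; first exact: f1r.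
    by apply: f2r; rewrite inE vB.
  have [nB|nnB] := boolP (near B u).
    apply: leq_trans (f1c u); apply: subset_leq_card; apply/subsetP=> v.
    rewrite !inE; case vB: (v \in B) => /= /andP[vX f2v] //.
    have := f2c u; rewrite /= nB leqn0 cards_eq0 => /eqP/setP/(_ v).
    by rewrite !inE vB vX f2v.
  have := f2c u; rewrite /= (negPf nnB) => /(leq_trans _); apply.
  apply: subset_leq_card; apply/subsetP=> v; rewrite !inE => /andP[vX].
  case: ifP => [vB /eqP f1v|vB ->]; last by rewrite vX.
  have [u' f1u' ru'] := f1r _ vB.
  move: f1u'; rewrite f1v => -[?]; subst u'.
  by case/negP: nnB; apply/exists_inP; exists v.
(* Without a tight set, [v0] can be served first: its singleton yields a [u0] with spare
   capacity. *)
have [u0 ru0 cu0] : exists2 u, r v0 u & 0 < c u.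
  have /hall : [set v0] \subset X by rewrite sub1set.
  rewrite cards1 lt0n sum_nat_eq0 => /forallPn[u]; rewrite negb_imply -lt0n.
  case/andP=> /exists_inP[v]; rewrite inE => /eqP-> rv cu.
  by exists u.
(* Taking one unit from [u0] costs any [A] at most one, and Hall's inequality is strict for every
   nonempty proper subset of [X]. *)
have [|A AD|f [fr fc]] := IH (X :\ v0) (fun u => c u - (u == u0)).
- by have := cardsD1 v0 X; rewrite v0X; lia.
- have [->|An0] := eqVneq A set0; first by rewrite cards0.
  have AX : A \proper X.
    apply: sub_proper_trans AD _; rewrite properE subsetDl /=.
    by apply/subsetPn; exists v0 => //; rewrite !inE eqxx.
  have := hall _ (proper_sub AX).
  have := slack A; rewrite An0 AX /= => ne le.
  have {ne le} : #|A| < \sum_(u | near A u) c u by rewrite ltn_neqAle ne.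
  have : \sum_(u | near A u) c u <=
         \sum_(u | near A u) (c u - (u == u0)) + \sum_(u | near A u) (u == u0).
    by rewrite -big_split; apply: leq_sum => u _ /=; lia.
  have : \sum_(u | near A u) (u == u0) <= 1.
    apply: (leq_trans (n := \sum_u (u == u0))).
      by rewrite big_mkcond; apply: leq_sum => u _; case: ifP.
    by rewrite (bigD1 u0) //= eqxx big1 // => u /negPf->.
  rewrite /near; lia.
exists (fun v => if v == v0 then Some u0 else f v); split=> [v vX|u].
  case: eqP => [->|/eqP vv0]; first by exists u0.
  by apply: fr; rewrite !inE vv0.
have := fc u.
have sub : [set v in X | (if v == v0 then Some u0 else f v) == Some u] \subset
   [set v in X :\ v0 | f v == Some u] :|: (if u == u0 then [set v0] else set0).
  apply/subsetP=> v; rewrite !inE; case: (v =P v0) => [->|_] /andP[vX].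
    by move=> /eqP[->]; rewrite eqxx inE eqxx orbT.
  by move=> ->; rewrite vX.
have := subset_leq_card sub.
have := cardsU [set v in X :\ v0 | f v == Some u] (if u == u0 then [set v0] else set0).
case: eqP => [->|_]; rewrite ?cards1 ?cards0; lia.
Qed.

Local Open Scope ring_scope.

(** * Carrying integral parts along a tree *)

(** A [realFieldType] need not be archimedean, hence the explicit bound [B]. *)
Lemma nat_floor (R : realFieldType) (B : nat) (x : R) :
  0 <= x -> x < B%:R -> exists n : nat, n%:R <= x < n%:R + 1.
Proof.
move=> x0; elim: B => [|B IH] xB; first by move: x0; rewrite leNgt xB.
have [/IH//|Bx] := ltP x B%:R.
by exists B; rewrite Bx -natr1 in xB *.
Qed.

(** Recursion from high rank to low rank, unrolled as an induction on the number [d] of top ranks at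
    which the equation already holds. *)
Lemma carry_exists (R : realFieldType) (T : finType) (rk : T -> nat)
    (ch : rel T) (a : T -> R) (B : nat) :
  (forall m c, ch m c -> (rk m < rk c)%N) ->
  (forall m, 0 <= a m <= B%:R) ->
  exists (rho : T -> R) (n : T -> nat), forall m,
    0 <= rho m < 1 /\ a m + \sum_(c | ch m c) rho c = (n m)%:R + rho m.
Proof.
move=> rkch aB.
have step (rho : T -> R) : (forall m, 0 <= rho m < 1) ->
    forall m, exists nr : nat * R,
      0 <= nr.2 < 1 /\ a m + \sum_(c | ch m c) rho c = nr.1%:R + nr.2.
  move=> rho01 m; have [||n /andP[nx xn]] :=
    @nat_floor R (B + #|T|).+1 (a m + \sum_(c | ch m c) rho c).
  - rewrite addr_ge0 ?sumr_ge0 //; first by case/andP: (aB m).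
    by move=> c _; case/andP: (rho01 c).
  - rewrite -natr1 natrD ltr_pwDr // lerD //; first by case/andP: (aB m).
    rewrite big_mkcond -sum1_card natr_sum; apply: ler_sum => c _.
    by case/andP: (rho01 c) => _ lt1; case: ifP => // _; apply: ltW.
  by exists (n, a m + \sum_(c | ch m c) rho c - n%:R); split=> /=; lra.
(* [K] exceeds every rank: nothing is required at [d = 0], everything once [d] reaches [K]. *)
pose K := (\max_m rk m).+1.
have [d] : exists d, (K <= d)%N by exists K.
suff main : exists (rho : T -> R) (n : T -> nat), forall m, 0 <= rho m < 1 /\
   ((K <= rk m + d)%N -> a m + \sum_(c | ch m c) rho c = (n m)%:R + rho m).
  case: main => rho [n main] Kd; exists rho, n => m; have [? eqm] := main m.
  by split=> //; apply: eqm; apply: leq_trans Kd (leq_addl _ _).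
elim: d => [|d [rho [n IH]]].
  exists (fun=> 0), (fun=> 0%N) => m; rewrite lexx ltr01; split=> //.
  by rewrite addn0 ltnNge leq_bigmax.
have /step/fin_all_exists[f fP] m : 0 <= rho m < 1 by case: (IH m).
(* Settled elements keep their values. Children of a newly settled element have larger rank, so they
   were settled before and their residues do not change. *)
exists (fun m => if (K <= rk m + d)%N then rho m else (f m).2),
  (fun m => if (K <= rk m + d)%N then n m else (f m).1) => m.
split; first by case: ifP => _; [case: (IH m) | case: (fP m)].
move=> Km; rewrite (eq_bigr rho) => [|c /rkch rkc]; last first.
  by rewrite ifT // (leq_trans Km) // addnS -addSn leq_add2r.
by case: ifP => [/(proj2 (IH m))|_]; [| case: (fP m)].
Qed.

(** * Clusters and the tree of monarchs *)

(** [M] holds the monarchs, [cl u] is the monarch of [u], and [r] is the root. A tree edge from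
    [p c] to [c] has its first intermediate vertex recorded as the link [l c]; the rank keeps parent
    pointers acyclic. *)
Record clustering (T : finType) (e : rel T) (M : {set T}) (r : T)
    (cl p l : T -> T) (rk : T -> nat) : Prop := Clustering {
  cl_in : forall u, cl u \in M;
  cl_near : forall u, within e 2 (cl u) u;
  cl_ball : forall m u, m \in M -> within e 1 m u -> cl u = m;
  root_in : r \in M;
  parent_in : forall c, c \in M -> c != r -> p c \in M;
  link_edge : forall c, c \in M -> c != r -> e (p c) (l c);
  link_near : forall c, c \in M -> c != r -> within e 2 (l c) c;
  parent_rank : forall c, c \in M -> c != r -> (rk (p c) < rk c)%N }.

(** Monarchs are added greedily, each at distance 3 from an earlier one, until every vertex is
    within 2 of a monarch; connectedness guarantees that a next one can be found. *)
Lemma clustering_exists (T : finType) (e : rel T) (r : T) :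
  symmetric e -> connected_graph e ->
  exists M cl p l rk, clustering e M r cl p l rk.
Proof.
move=> sym conn.
pose tree (M : {set T}) (p l : T -> T) (rk : T -> nat) :=
  [/\ r \in M,
      {in M &, forall m m', within e 2 m m' -> m = m'}
    & {in M, forall c, c != r ->
       [/\ p c \in M, e (p c) (l c), within e 2 (l c) c & (rk (p c) < rk c)%N]}].
have [M [p [l [rk [[rM sep par] dom]]]]] : exists M p l rk, tree M p l rk /\
    forall u, exists2 m, m \in M & within e 2 m u.
  (* For [n] equal to the number of vertices, the second alternative is impossible. *)
  suff grow n : exists M p l rk, tree M p l rk /\
      ((forall u, exists2 m, m \in M & within e 2 m u) \/ (n < #|M|)%N).
    have [M [p [l [rk [tr [dom|ltM]]]]]] := grow #|T|; first by exists M, p, l, rk.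
    by have := leq_ltn_trans (max_card (mem M)) ltM; rewrite ltnn.
  elim: n => [|n [M [p [l [rk [tr [dom|ltM]]]]]]].
  - exists [set r], id, id, (fun=> 0%N); split; last by right; rewrite cards1.
    split; first by rewrite inE.
      by move=> m m'; rewrite !inE => /eqP-> /eqP->.
    by move=> c; rewrite inE => /eqP->; rewrite eqxx.
  - by exists M, p, l, rk; split=> //; left.
  have [rM sep par] := tr.
  have [/forallP dom|/forallPn[u farU]] :=
    boolP [forall u, [exists m in M, within e 2 m u]].
    by exists M, p, l, rk; split=> //; left=> u; apply/exists_inP.
  (* On a walk from [r] to the far vertex [u], the first vertex not within 2 of [M] follows one that
     is, so it is within 3 of a monarch. *)
  have [c [m [mM mc farc]]] : exists c m, [/\ m \in M, within e 3 m c &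
      forall m', m' \in M -> ~~ within e 2 m' c].
    have /connectP[q pq lq] := conn r u.
    have near_r : [exists m in M, within e 2 m r].
      by apply/exists_inP; exists r => //; apply: within_refl.
    move: (r) near_r pq lq; elim: q => [|w q IH] r' near_r' /=.
      by move=> _ eu; rewrite eu near_r' in farU.
    case/andP=> r'w pq lq.
    have [/IH|farw] := boolP [exists m in M, within e 2 m w]; first exact.
    case/exists_inP: near_r' => m mM mr'; exists w, m; split=> //.
      exact: within_trans mr' (within_edge r'w).
    by move=> m' m'M; move/exists_inPn: farw => /(_ m' m'M).
  have /existsP[a /andP[ma ac]] := mc.
  (* A first step standing still would put [c] within 2 of [m]. *)
  have {}ma : e m a.
    by case/orP: ma => // /eqP ma; case/negP: (farc _ mM); rewrite ma.
  have cM : c \notin M by apply/negP=> /farc; rewrite within_refl.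
  have neqc x : x \in M -> (x == c) = false.
    by move=> xM; apply: contraNF cM => /eqP<-.
  pose upd A (f : T -> A) v x := if x == c then v else f x.
  exists (c |: M), (upd _ p m), (upd _ l a), (upd _ rk (rk m).+1).
  split; last by right; rewrite cardsU1 cM.
  split; first by rewrite !inE rM orbT.
    move=> x x' /setU1P[->|xM] /setU1P[->|x'M] //.
    - by rewrite within_sym // (negPf (farc _ x'M)).
    - by rewrite (negPf (farc _ xM)).
    - exact: sep.
  rewrite /upd => x /setU1P[->|xM] xr.
    by rewrite eqxx (neqc m) // !inE mM orbT.
  have [pM lk near rkx] := par _ xM xr.
  by rewrite (neqc x) // (neqc (p x)) // !inE pM orbT.
(* A monarch with [u] in its closed neighbourhood takes precedence; separation makes it unique.
   Otherwise any monarch within 2 serves. *)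
have /fin_all_exists[cl clP] u : exists m, [/\ m \in M, within e 2 m u &
    forall m', m' \in M -> within e 1 m' u -> m = m'].
  have [/exists_inP[m mM mu]|/exists_inPn none] :=
    boolP [exists m in M, within e 1 m u].
    exists m; split=> // [|m' m'M m'u]; first exact: (@within_mono _ e 1).
    apply: sep => //; apply: (within_trans (d1 := 1) (d2 := 1)) mu _.
    by rewrite within_sym.
  have [m mM mu] := dom u; exists m; split=> // m' m'M m'u.
  by case/negP: (none _ m'M).
exists M, cl, p, l, rk; split=> //.
- by move=> u; case: (clP u).
- by move=> u; case: (clP u).
- by move=> m u mM mu; case: (clP u) => _ _; apply.
- by move=> c cM cr; case: (par c cM cr).
- by move=> c cM cr; case: (par c cM cr).
- by move=> c cM cr; case: (par c cM cr).
- by move=> c cM cr; case: (par c cM cr).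
Qed.

(** * Choosing the slots opened at a monarch *)

Lemma subset_card_between (T : finType) (A B : {set T}) (n : nat) :
  A \subset B -> (#|A| <= n <= #|B|)%N ->
  exists C : {set T}, [/\ A \subset C, C \subset B & #|C| = n].
Proof.
move=> AB /andP[]; elim: n => [|n IH] An nB.
  by exists A; split=> //; apply/eqP; rewrite -leqn0.
move: An; rewrite leq_eqVlt => /predU1P[An|An]; first by exists A.
have [C [AC CB cC]] := IH An (ltnW nB).
have /properP[_ [x xB xC]] : C \proper B by rewrite properEcard CB cC.
exists (x |: C); split; last by rewrite cardsU1 xC cC.
  by apply: subset_trans AC (subsetUr _ _).
by rewrite subUset sub1set xB.
Qed.

(* A link [a] serves as a buffer: the floor of the residues hanging from [a]
   is opened among these children, the fractional rest goes to [N]. *)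
Lemma slot_choice (R : realFieldType) (T : finType) (Sl Ch N : {set T})
    (l : T -> T) (rho : T -> R) (n : nat) :
  Ch \subset Sl -> N \subset Sl -> [disjoint Ch & N] ->
  (forall c, c \in Ch -> l c \in N) ->
  (forall c, c \in Ch -> 0 <= rho c <= 1) ->
  \sum_(c in Ch) rho c <= n%:R -> (n <= #|Sl|)%N ->
  exists O : {set T}, [/\ O \subset Sl, #|O| = n & forall P : pred T,
    \sum_(c in Ch | P (l c)) rho c <=
    #|[set v in O | (v \in N) || (v \in Ch) && P (l v)]|%:R].
Proof.
move=> ChSl NSl disj lN rho01 sum_le n_le.
pose F a := \sum_(c in Ch | l c == a) rho c.
have F0 a : 0 <= F a.
  by apply: sumr_ge0 => c /andP[/rho01/andP[]].
(* [Bs a] consists of as many children hanging from [a] as the floor of [F a]; there are enough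
   since each residue is at most 1. *)
have /fin_all_exists[Bs BsP] a : exists B : {set T},
    B \subset [set c in Ch | l c == a] /\ #|B|%:R <= F a < #|B|%:R + 1.
  have Fle : F a <= #|[set c in Ch | l c == a]|%:R.
    rewrite -sum1_card natr_sum (eq_bigl _ _ (fun c => in_set _ c)).
    by apply: ler_sum => c /andP[/rho01/andP[]].
  have [|j /andP[jF Fj]] :=
    @nat_floor R #|[set c in Ch | l c == a]|.+1 _ (F0 a).
    by apply: le_lt_trans Fle _; rewrite ltr_nat.
  have [|C [_ CK cC]] := @subset_card_between _ set0 [set c in Ch | l c == a] j (sub0set _).
    by rewrite cards0 /= -(ler_nat R); apply: le_trans Fle.
  by exists C; rewrite cC jF Fj.
pose B := [set c in Ch | c \in Bs (l c)].
have sumP (P : pred T) (f : T -> R) (D : {set T}) : D \subset Ch ->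
    \sum_(c in D | P (l c)) f c =
    \sum_(a in N | P a) \sum_(c in D | l c == a) f c.
  move=> DCh; rewrite (partition_big l (fun a => (a \in N) && P a)) /=.
    apply: eq_bigr => a /andP[_ Pa]; apply: eq_bigl => c.
    by case: (l c =P a) => [->|_]; rewrite ?Pa ?andbT ?andbF.
  by move=> c /andP[/(subsetP DCh)/lN-> ->].
have BCh : B \subset Ch by apply/subsetP=> c; rewrite inE => /andP[].
have cardB (P : pred T) : #|[set c in B | P (l c)]|%:R =
    \sum_(a in N | P a) #|Bs a|%:R :> R.
  rewrite -sum1_card natr_sum (eq_bigl _ _ (fun c => in_set _ c)) sumP //.
  apply: eq_bigr => a _; rewrite -sum1_card natr_sum; apply: eq_bigl => c.
  rewrite !inE; case: (BsP a) => /subsetP sub _.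
  apply/andP/idP => [[/andP[_]] cB /eqP<- //|cB].
  by have := sub _ cB; rewrite inE => /andP[cCh /eqP lc]; rewrite cCh lc eqxx.
have lower (P : pred T) :
    #|[set c in B | P (l c)]|%:R <= \sum_(c in Ch | P (l c)) rho c.
  by rewrite cardB sumP //; apply: ler_sum => a _; case: (BsP a) => _ /andP[].
(* Flooring loses at most one per link, and the links lie in [N]. *)
have upper (P : pred T) :
    \sum_(c in Ch | P (l c)) rho c <= #|[set c in B | P (l c)]|%:R + #|N|%:R.
  rewrite cardB sumP //.
  apply: (le_trans (y := \sum_(a in N | P a) (#|Bs a|%:R + 1))).
    by apply: ler_sum => a _; case: (BsP a) => _ /andP[_ /ltW].
  rewrite big_split /= lerD2l -sum1_card natr_sum big_mkcondr /=.
  by apply: ler_sum => a _; case: ifP.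
have Bn : (#|B| <= n)%N.
  rewrite -(ler_nat R); apply: le_trans sum_le.
  have := lower xpredT; rewrite (_ : [set c in B | _] = B); last first.
    by apply/setP=> c; rewrite inE andbT.
  by rewrite (eq_bigl (mem Ch)) // => c; rewrite /= andbT.
(* If [O] lies between [B] and [B :|: N], its only useless slots are the members of [B] failing [P].
   By [lower] these are at most the residues failing [P], and [n] is at least the sum of all
   residues. *)
have [n_small|n_big] := leqP n #|B :|: N|.
  have [|O [BO OX cO]] := @subset_card_between _ B (B :|: N) n (subsetUl _ _).
    by rewrite Bn.
  exists O; split=> // [|P].
    by apply: subset_trans OX _; rewrite subUset NSl (subset_trans BCh).
  have sub : O :\: [set c in B | ~~ P (l c)] \subset
      [set v in O | (v \in N) || (v \in Ch) && P (l v)].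
    apply/subsetP=> v /setDP[vO nB]; rewrite inE vO /=.
    have /setUP[vB|->//] := subsetP OX _ vO.
    move: nB; rewrite inE vB negbK (subsetP BCh _ vB) => /= ->.
    by rewrite orbT.
  have := subset_leq_card sub; rewrite cardsD -(ler_nat R).
  have le1 : (#|O :&: [set c in B | ~~ P (l c)]| <= #|[set c in B | ~~ P (l c)]|)%N.
    by apply: subset_leq_card; apply: subsetIr.
  have le2 : (#|O :&: [set c in B | ~~ P (l c)]| <= #|O|)%N.
    by apply: subset_leq_card; apply: subsetIl.
  rewrite natrB // cO; have := lower (predC P).
  have := sum_le; rewrite (bigID (fun c => P (l c))) /= => h1 h2.
  by move: le1; rewrite -(ler_nat R); lra.
(* Here all of [B :|: N] is opened, and [upper] suffices. *)
have [||O [XO OS cO]] := @subset_card_between _ (B :|: N) Sl n.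
- by rewrite subUset NSl (subset_trans BCh).
- by rewrite (ltnW n_big).
exists O; split=> // P.
have sub : [set c in B | P (l c)] :|: N \subset
    [set v in O | (v \in N) || (v \in Ch) && P (l v)].
  apply/subsetP=> v /setUP[|vN]; last first.
    by rewrite inE vN (subsetP XO) // inE vN orbT.
  rewrite inE => /andP[vB Pv]; rewrite inE Pv (subsetP BCh _ vB) orbT andbT.
  by rewrite (subsetP XO) // inE vB.
apply: le_trans (upper P) _; rewrite -natrD ler_nat.
apply: leq_trans (subset_leq_card sub); rewrite cardsU.
rewrite (_ : _ :&: N = set0) ?cards0 ?subn0 //; apply/setP=> v; rewrite !inE.
apply/negP=> /andP[/andP[/andP[vCh _] _] vN].
by move: disj; rewrite disjoint_subset => /subsetP/(_ _ vCh); rewrite inE vN.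
Qed.

(** * Residues and the opening reserved for them *)

(** The root is excluded because a clustering leaves [p r] arbitrary. *)
Definition child (T : finType) (M : {set T}) (r : T) (p : T -> T) (m c : T) :=
  [&& c \in M, c != r & p c == m].

(* [rho m] is the residue that [m] passes to its parent and [z u] is the part
   of the opening [y u] which makes it up. *)
Record reserve (R : realFieldType) (T : finType) (e : rel T) (M : {set T})
    (r : T) (cl p : T -> T) (y : T -> R) (k : nat)
    (rho : T -> R) (n : T -> nat) (z : T -> R) : Prop := Reserve {
  rho01 : forall m, 0 <= rho m < 1;
  rho_root : rho r = 0;
  n_sum : (\sum_(m in M) n m)%N = k;
  z_bound : forall u, 0 <= z u <= y u;
  z_supp : forall u, ~~ within e 1 (cl u) u -> z u = 0;
  z_sum : forall c, c \in M -> \sum_(u | cl u == c) z u = rho c;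
  carry : forall m, m \in M ->
    \sum_(u | cl u == m) y u + \sum_(c | child M r p m c) rho c =
    (n m)%:R + rho m }.

(** The residues come from [carry_exists] on the tree. A closed neighbourhood carries at least 1,
    more than the residue, so it can pay by scaling its opening. *)
Lemma reserve_exists (R : realFieldType) (T : finType) (e : rel T)
    (M : {set T}) (r : T) (cl p l : T -> T) (rk : T -> nat) (y : T -> R)
    (k : nat) :
  clustering e M r cl p l rk -> (forall u, 0 <= y u) ->
  \sum_u y u = k%:R ->
  (forall m, m \in M -> 1 <= \sum_(u | within e 1 m u) y u) ->
  exists rho n z, reserve e M r cl p y k rho n z.
Proof.
move=> clus y0 ysum ball.
have [|m|rho [n rhon]] := @carry_exists R T rk (child M r p)
  (fun m => \sum_(u | cl u == m) y u) k.
- by move=> m c /and3P[cM cr /eqP<-]; apply: parent_rank clus _ cM cr.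
- rewrite sumr_ge0 //= -ysum [leRHS](bigID (fun u => cl u == m)) /= lerDl.
  by rewrite sumr_ge0.
have r01 m : 0 <= rho m < 1 by case: (rhon m).
(* Summed over all monarchs, the residues cancel except at the root. Since [k] is an integer and
   [rho r] lies below 1, [rho r] must vanish. *)
have key : k%:R = (\sum_(m in M) n m)%:R + rho r.
  have : \sum_(m in M) (\sum_(u | cl u == m) y u +
      \sum_(c | child M r p m c) rho c) = \sum_(m in M) ((n m)%:R + rho m).
    by apply: eq_bigr => m _; case: (rhon m).
  rewrite !big_split /= -natr_sum.
  have -> : \sum_(m in M) \sum_(u | cl u == m) y u = k%:R.
    rewrite -ysum [RHS](partition_big cl (mem M)) //=.
    by move=> u _; apply: cl_in clus u.
  have -> : \sum_(m in M) \sum_(c | child M r p m c) rho c =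
            \sum_(c in M | c != r) rho c.
    rewrite [RHS](partition_big p (mem M) (P := fun c => (c \in M) && (c != r))) /=.
      by apply: eq_bigr => m _; apply: eq_bigl => c; rewrite /child andbA.
    by move=> c /andP[cM cr]; apply: parent_in clus c cM cr.
  rewrite [\sum_(m in M) rho m](bigD1 r) /=; last exact: root_in clus.
  by move=> h; lra.
have nk : (\sum_(m in M) n m)%N = k.
  have /andP[r0 r1] := r01 r.
  apply/eqP; rewrite eqn_leq -(ler_nat R); apply/andP; split; first lra.
  by rewrite -ltnS -(ltr_nat R) -natr1; lra.
pose w m := \sum_(u | within e 1 m u) y u.
pose z u := if within e 1 (cl u) u then y u * (rho (cl u) / w (cl u)) else 0.
exists rho, n, z; split=> //.
- by move: key; rewrite nk; lra.
- move=> u; rewrite /z; case: ifP => _; last by rewrite lexx y0.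
  have w1 := ball _ (cl_in clus u); rewrite -/(w _) in w1.
  have w0 : 0 < w (cl u) by apply: lt_le_trans w1.
  have /andP[rho0 rho1] := r01 (cl u).
  rewrite mulr_ge0 ?divr_ge0 ?(ltW w0) //= ler_piMr //.
  by rewrite ler_pdivrMr // mul1r (le_trans (ltW rho1)).
- by move=> u /negPf; rewrite /z => ->.
- move=> c cM; have w1 := ball _ cM; rewrite -/(w _) in w1.
  have w0 : w c != 0 by apply: lt0r_neq0; apply: lt_le_trans w1.
  rewrite (eq_bigr (fun u => if within e 1 c u then y u * (rho c / w c) else 0));
    last by move=> u /eqP eu; rewrite /z eu.
  rewrite -big_mkcondr (eq_bigl (fun u => within e 1 c u)) => [|u].
    by rewrite -mulr_suml -/(w c) mulrC divfK.
  apply/andP/idP => [[]//|cu]; split=> //; apply/eqP.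
  exact: cl_ball clus c u cM cu.
- by move=> m _; case: (rhon m).
Qed.

Lemma reserve_children (R : realFieldType) (T : finType) (e : rel T)
    (M : {set T}) (r : T) (cl p : T -> T) (y : T -> R) (k : nat)
    (rho : T -> R) (n : T -> nat) (z : T -> R) (Q : pred T) :
  reserve e M r cl p y k rho n z -> (forall c, Q c -> c \in M) ->
  \sum_(u | Q (cl u)) z u = \sum_(c | Q c) rho c.
Proof.
move=> res QM; rewrite (partition_big cl Q) //=; apply: eq_bigr => c Qc.
rewrite -(z_sum res (QM _ Qc)); apply: eq_bigl => u.
by case: (cl u =P c) => [->|_]; rewrite ?Qc ?andbF.
Qed.

Lemma reserve_mass (R : realFieldType) (T : finType) (e : rel T)
    (M : {set T}) (r : T) (cl p : T -> T) (y : T -> R) (k : nat)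
    (rho : T -> R) (n : T -> nat) (z : T -> R) (m : T) :
  reserve e M r cl p y k rho n z -> m \in M ->
  \sum_(u | cl u == m) (y u - z u) + \sum_(u | child M r p m (cl u)) z u =
  (n m)%:R.
Proof.
move=> res mM; rewrite sumrB (z_sum res mM) (reserve_children res) => [|c /and3P[]//].
by have := carry res mM; lra.
Qed.

(** * Transfer of the opening to monarchs and slots *)

(** The share of the opening of [U] that ends up at [m]: what its cluster keeps, plus what the
    clusters of its children pass on. *)
Definition local_mass (R : realFieldType) (T : finType) (M : {set T}) (r : T)
    (cl p : T -> T) (y z : T -> R) (U : {set T}) (m : T) : R :=
  \sum_(u in U | cl u == m) (y u - z u) +
  \sum_(u in U | child M r p m (cl u)) z u.

Lemma local_mass_le (R : realFieldType) (T : finType) (e : rel T)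
    (M : {set T}) (r : T) (cl p : T -> T) (y : T -> R) (k : nat)
    (rho : T -> R) (n : T -> nat) (z : T -> R) (U : {set T}) (m : T) :
  reserve e M r cl p y k rho n z -> m \in M ->
  local_mass M r cl p y z U m <= (n m)%:R.
Proof.
move=> res mM; rewrite -(reserve_mass res mM); apply: lerD.
  rewrite big_mkcond [leRHS]big_mkcond; apply: ler_sum => u _.
  have /andP[_ zy] := z_bound res u.
  by case: (u \in U) => //=; case: ifP => // _; rewrite subr_ge0.
rewrite big_mkcond [leRHS]big_mkcond; apply: ler_sum => u _.
have /andP[z0 _] := z_bound res u.
by case: (u \in U) => //=; case: ifP.
Qed.

Lemma sum_local_mass (R : realFieldType) (T : finType) (e : rel T)
    (M : {set T}) (r : T) (cl p l : T -> T) (rk : T -> nat) (y : T -> R)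
    (k : nat) (rho : T -> R) (n : T -> nat) (z : T -> R) (U : {set T}) :
  clustering e M r cl p l rk -> reserve e M r cl p y k rho n z ->
  \sum_(u in U) y u = \sum_(m in M) local_mass M r cl p y z U m.
Proof.
move=> clus res; rewrite big_split /= -(partition_big cl (mem M)) /=; last first.
  by move=> u _; apply: cl_in clus u.
have -> : \sum_(m in M) \sum_(u in U | child M r p m (cl u)) z u =
    \sum_(u in U | cl u != r) z u.
  rewrite [RHS](partition_big (p \o cl) (mem M)) /=.
    apply: eq_bigr => m _; apply: eq_bigl => u.
    by rewrite /child (cl_in clus) /= andbA.
  by move=> u /andP[_ ur]; apply: parent_in clus _ (cl_in clus u) ur.
(* On the root cluster [z] is nonnegative with sum [rho r = 0], so no reserved opening is lost
   there. *)
have -> : \sum_(u in U | cl u != r) z u = \sum_(u in U) z u.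
  rewrite [RHS](bigID (fun u => cl u != r)) /= [X in _ = _ + X]big1 ?addr0 //.
  move=> u /andP[_]; rewrite negbK => /eqP ur.
  have z0 v : 0 <= z v by case/andP: (z_bound res v).
  have := z_sum res (root_in clus); rewrite (rho_root res) => /psumr_eq0P.
  by apply=> [v _|]; rewrite ?z0 ?ur.
by rewrite sumrB subrK.
Qed.

(** Once every opened unit has an owner, Hall's condition can be checked one monarch at a time. *)
Lemma hall_of_local (R : realFieldType) (T : finType) (e : rel T)
    (M : {set T}) (r : T) (cl p l : T -> T) (rk : T -> nat) (y : T -> R)
    (k : nat) (rho : T -> R) (n : T -> nat) (z : T -> R)
    (owner : T -> T) (w : T -> nat) (near : pred T) (U : {set T}) :
  clustering e M r cl p l rk -> reserve e M r cl p y k rho n z ->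
  (forall m, m \in M -> local_mass M r cl p y z U m <=
     (\sum_(v | near v && (owner v == m)) w v)%:R) ->
  \sum_(u in U) y u <= (\sum_(v | near v) w v)%:R.
Proof.
move=> clus res loc; rewrite (sum_local_mass U clus res).
apply: (le_trans (ler_sum _ loc)); rewrite -natr_sum ler_nat.
rewrite [leqRHS](partition_big owner xpredT) //= [leqRHS](bigID (mem M)) /=.
exact: leq_addr.
Qed.

(** Opening kept in a cluster travels at most 2. Reserved opening travels 1 to its own monarch and 3
    along the tree edge. So a monarch farther than 4 from [U] receives nothing from it. *)
Lemma soft_transfer (R : realFieldType) (T : finType) (e : rel T)
    (M : {set T}) (r : T) (cl p l : T -> T) (rk : T -> nat) (y : T -> R)
    (k : nat) (rho : T -> R) (n : T -> nat) (z : T -> R) (U : {set T}) :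
  symmetric e ->
  clustering e M r cl p l rk -> reserve e M r cl p y k rho n z ->
  \sum_(u in U) y u <=
  (\sum_(v | [exists u in U, within e 4 u v]) (if v \in M then n v else 0))%:R.
Proof.
move=> sym clus res; apply: (hall_of_local (owner := id) clus res) => m mM.
have [nearm|farm] := boolP [exists u in U, within e 4 u m].
  apply: le_trans (local_mass_le U res mM) _; rewrite ler_nat.
  by rewrite (bigD1 m) /= ?nearm ?eqxx // mM leq_addr.
suff -> : local_mass M r cl p y z U m = 0 by rewrite ler0n.
rewrite /local_mass !big1 ?addr0 // => u /andP[uU].
  move/and3P=> [cM cr /eqP pc]; apply: (z_supp res).
  apply: contraNN farm => cu; apply/exists_inP; exists u => //.
  rewrite within_sym // -pc.
  apply: (within_trans (d1 := 1) (d2 := 3) (within_edge (link_edge clus cM cr))).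
  exact: (within_trans (d1 := 2) (d2 := 1) (link_near clus cM cr) cu).
move/eqP=> um; case/negP: farm; apply/exists_inP; exists u => //.
rewrite within_sym // -um; apply: (@within_mono _ e 2) => //.
exact: cl_near clus u.
Qed.

(** Each vertex has one owner, so the choices made at different monarchs are disjoint. Hall's
    condition is then checked at [m] according to whether [U] meets the cluster of [m] or only
    closed neighbourhoods of its children. *)
Lemma hard_transfer (R : realFieldType) (T : finType) (e : rel T)
    (M : {set T}) (r : T) (cl p l : T -> T) (rk : T -> nat) (y : T -> R)
    (k : nat) (rho : T -> R) (n : T -> nat) (z : T -> R) :
  symmetric e -> irreflexive e -> (forall u, y u <= 1) ->
  clustering e M r cl p l rk -> reserve e M r cl p y k rho n z ->
  exists2 S : {set T}, #|S| = k & forall U : {set T},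
    \sum_(u in U) y u <=
    (\sum_(v | [exists u in U, within e 5 u v]) (v \in S))%:R.
Proof.
move=> sym irr y1 clus res.
(* The slot at a monarch with a positive residue is left to its parent. *)
pose owner v := if (v \in M) && (0 < rho v) then p v else cl v.
pose Sl m := [set v | owner v == m].
pose Ch m := [set c | child M r p m c && (0 < rho c)].
pose N m := [set a | e m a].
have clM m : m \in M -> cl m = m.
  by move=> mM; apply: (cl_ball clus mM); apply: within_refl.
have chM m c : child M r p m c -> [/\ c \in M, c != r & p c = m].
  by case/and3P=> cM cr /eqP.
have nr m : 0 < rho m -> m != r.
  by apply: contraTneq => ->; rewrite (rho_root res) ltxx.
have clN m a : m \in M -> e m a -> cl a = m.
  by move=> mM ma; apply: cl_ball clus _ _ mM (within_edge ma).
have NM m a : m \in M -> e m a -> a \notin M.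
  move=> mM ma; apply/negP=> aM; have := clM _ aM.
  by rewrite (clN m) // => am; move: ma; rewrite am irr.
have ChSl m : Ch m \subset Sl m.
  apply/subsetP=> c; rewrite !inE => /andP[/chM[cM cr <-] rc].
  by rewrite /owner cM rc.
have NSl m : m \in M -> N m \subset Sl m.
  move=> mM; apply/subsetP=> a; rewrite !inE => ma.
  by rewrite /owner (negPf (NM _ _ mM ma)) (clN m).
have disj m : m \in M -> [disjoint Ch m & N m].
  move=> mM; apply/pred0P=> v /=; apply/negP; rewrite !inE.
  by case/andP=> /andP[/chM[vM _ _] _] /(NM _ _ mM); rewrite vM.
have sumCh m : \sum_(c in Ch m) rho c = \sum_(c | child M r p m c) rho c.
  rewrite [RHS](bigID (fun c => 0 < rho c)) /= [X in _ = _ + X]big1 ?addr0.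
    by apply: eq_bigl => c; rewrite inE.
  move=> c /andP[_]; rewrite -leNgt => rc; apply/eqP; rewrite eq_le rc.
  by case/andP: (rho01 res c).
have n_low m : m \in M -> \sum_(c in Ch m) rho c <= (n m)%:R.
  move=> mM; rewrite sumCh -(reserve_mass res mM) (reserve_children res).
    rewrite lerDr; apply: sumr_ge0 => u _; rewrite subr_ge0.
    by case/andP: (z_bound res u).
  by move=> c /chM[].
have n_high m : m \in M -> (n m <= #|Sl m|)%N.
  move=> mM; have [r0 r1] := andP (rho01 res m).
  (* Compared with the cluster, [Sl m] gains the children with positive residue and loses [m] itself
     if its own residue is positive. *)
  have cardSl : (#|Sl m| + (0 < rho m)%R = #|[set u | cl u == m]| + #|Ch m|)%N.
    have -> : #|Ch m| = #|Sl m :&: [set v in M | 0 < rho v]|.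
      apply: eq_card => v; rewrite !inE /owner /child.
      case vM: (v \in M) => /=; last by rewrite andbF.
      by case rv: (0 < rho v) => /=; rewrite ?andbF // nr.
    rewrite -(cardsID [set v in M | 0 < rho v] (Sl m)).
    rewrite -(cardsID [set v in M | 0 < rho v] [set u | cl u == m]).
    have -> : Sl m :\: [set v in M | 0 < rho v] =
              [set u | cl u == m] :\: [set v in M | 0 < rho v].
      apply/setP=> v; rewrite !inE /owner.
      by case: ((v \in M) && (0 < rho v)).
    have -> : #|[set u | cl u == m] :&: [set v in M | 0 < rho v]| = (0 < rho m).
      have -> : [set u | cl u == m] :&: [set v in M | 0 < rho v] =
                if 0 < rho m then [set m] else set0.
        apply/setP=> v; rewrite !inE; case: ifP => rm; rewrite !inE.
          apply/and3P/eqP => [[/eqP <- vM _]|->]; first by rewrite clM.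
          by rewrite clM.
        by apply/negP=> /and3P[/eqP + vM]; rewrite clM // => ->; rewrite rm.
      by case: ifP; rewrite ?cards1 ?cards0.
    by lia.
  have le_mass : (n m)%:R + rho m <= (#|Sl m| + (0 < rho m)%R)%:R.
    rewrite -(carry res mM) cardSl natrD -sumCh -!sum1_card !natr_sum.
    apply: lerD; last by apply: ler_sum => c _; case/andP: (rho01 res c) => _ /ltW.
    by rewrite (eq_bigl (fun u => cl u == m)) => [|u]; [apply: ler_sum | rewrite inE].
  (* The slot lost at [m] does no harm: [n m] is strictly below [n m + rho m], which is at most
     [#|Sl m| + 1], and both counts are integers. *)
  have [rm|rm] := ltP 0 (rho m).
    rewrite -ltnS -(ltr_nat R) -addn1; apply: lt_le_trans (_ : (n m)%:R + rho m <= _).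
      by rewrite ltrDl.
    by move: le_mass; rewrite rm.
  move: le_mass; rewrite ltNge rm addn0 => le_mass.
  by rewrite -(ler_nat R); apply: le_trans le_mass; rewrite lerDl.
have /fin_all_exists[O OP] m : exists O : {set T}, m \in M ->
    [/\ O \subset Sl m, #|O| = n m & forall P : pred T,
    \sum_(c in Ch m | P (l c)) rho c <=
    #|[set v in O | (v \in N m) || (v \in Ch m) && P (l v)]|%:R].
  have [mM|_] := boolP (m \in M); last by exists set0.
  have [|c|O OP] := slot_choice (ChSl m) (NSl m mM) (disj m mM) (l := l) _ _
    (n_low m mM) (n_high m mM).
  - move=> c; rewrite !inE => /andP[/chM[cM cr <-] _].
    exact: link_edge clus c cM cr.
  - by case/andP: (rho01 res c) => -> /ltW.
  by exists O.
pose S := [set v in [set v | owner v \in M] | v \in O (owner v)].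
have SO m v : m \in M -> (v \in S) && (owner v == m) = (v \in O m).
  move=> mM; have [/subsetP sub _ _] := OP m mM.
  apply/andP/idP => [[+ /eqP vm]|vO]; first by rewrite !inE vm => /andP[].
  by have := sub _ vO; rewrite !inE => /eqP vm; rewrite vm mM vO eqxx.
exists S => [|U].
  rewrite -(n_sum res) -sum1_card (partition_big owner (mem M)) /=; last first.
    by move=> v; rewrite !inE => /andP[].
  apply: eq_bigr => m mM; have [_ <- _] := OP m mM.
  by rewrite -sum1_card; apply: eq_bigl => v; rewrite SO.
apply: (hall_of_local (owner := owner) clus res) => m mM.
have [_ cardO subO] := OP m mM.
have -> : (\sum_(v | [exists u in U, within e 5 u v] && (owner v == m)) (v \in S) =
    #|[set v in O m | [exists u in U, within e 5 u v]]|)%N.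
  rewrite -sum1_card big_mkcond [RHS]big_mkcond; apply: eq_bigr => v _.
  by rewrite inE -SO //; case: (v \in S); case: (owner v == m); case: [exists _ in _, _].
have toN u v : within e 2 u m -> v \in N m -> within e 5 u v.
  rewrite inE => um mv; apply: (@within_mono _ e 3) => //.
  exact: (within_trans (d1 := 2) (d2 := 1) um (within_edge mv)).
(* If [U] meets the cluster, all of [O m] is near: 2 to [m], then 2 to a slot in the cluster or 3 to
   a child. *)
have [/exists_inP[u uU /eqP um]|/exists_inPn none] := boolP [exists u in U, cl u == m].
  apply: le_trans (local_mass_le U res mM) _; rewrite ler_nat -cardO.
  apply: subset_leq_card; apply/subsetP=> v vO; rewrite inE vO.
  apply/exists_inP; exists u => //.
  have um2 : within e 2 u m by rewrite within_sym // -um; apply: cl_near clus u.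
  have := vO; rewrite -SO // /owner => /andP[_]; case: ifP => [/andP[vM rv]|_] /eqP vm.
    have vr := nr _ rv.
    apply: (within_trans (d1 := 2) (d2 := 3) um2).
    rewrite -vm; apply: (@within_trans _ e 1 2 _ (l v)).
      exact: within_edge (link_edge clus vM vr).
    exact (link_near clus vM vr).
  apply: (@within_mono _ e 4) => //; apply: (within_trans (d1 := 2) (d2 := 2) um2).
  by rewrite -vm; apply: cl_near clus v.
rewrite /local_mass big1 ?add0r => [|u /andP[uU um]]; last by rewrite (negPf (none _ uU)) in um.
have to_link u : child M r p m (cl u) -> within e 1 (cl u) u ->
    within e 3 u (l (cl u)).
  move=> /chM[cM cr _] cu; rewrite within_sym //.
  exact: (within_trans (d1 := 2) (d2 := 1) (link_near clus cM cr) cu).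
have [/exists_inP[u0 u0U /andP[ch0 near0]]|/exists_inPn untouched] :=
  boolP [exists u in U, child M r p m (cl u) && within e 1 (cl u) u]; last first.
  rewrite big1 // => u /andP[uU chu]; apply: (z_supp res).
  by have := untouched _ uU; rewrite chu.
(* [P] selects the links from which hangs a child whose closed neighbourhood meets [U]; only
   residues over such links matter. *)
pose P a := [exists u in U, [&& child M r p m (cl u), within e 1 (cl u) u & l (cl u) == a]].
apply: (le_trans (y := \sum_(c in Ch m | P (l c)) rho c)).
  have -> : \sum_(c in Ch m | P (l c)) rho c = \sum_(c | child M r p m c && P (l c)) rho c.
    rewrite [RHS](bigID (fun c => 0 < rho c)) /= [X in _ = _ + X]big1 ?addr0.
      by apply: eq_bigl => c; rewrite inE andbAC.
    move=> c /andP[_]; rewrite -leNgt => rc; apply/eqP; rewrite eq_le rc.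
    by case/andP: (rho01 res c).
  rewrite -(reserve_children (Q := fun c => child M r p m c && P (l c)) res).
    rewrite big_mkcond [leRHS]big_mkcond; apply: ler_sum => u _ /=.
    have /andP[z0 _] := z_bound res u.
    case uU: (u \in U) => /=; last by case: ifP.
    case chu: (child M r p m (cl u)) => //=.
    have [cu|/(z_supp res)->] := boolP (within e 1 (cl u) u); last by case: ifP.
    by rewrite ifT //; apply/exists_inP; exists u; rewrite // chu cu eqxx.
  by move=> c /andP[/chM[]].
apply: le_trans (subO P) _; rewrite ler_nat.
apply: subset_leq_card; apply/subsetP=> v; rewrite [in X in X -> _]inE [in X in _ -> X]inE.
(* From [U] to the link takes 3. A neighbour of [m] is two edges further, through [m]; a sibling on
   the same link is within 2 of it. *)
case/andP=> vO; rewrite vO => /orP[vN|/andP[vCh /exists_inP[u uU /and3P[chu cu /eqP lu]]]].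
  apply/exists_inP; exists u0 => //.
  have [cM cr pc] := chM _ _ ch0.
  apply: (within_trans (d1 := 3) (d2 := 2)) (to_link _ ch0 near0) _.
  rewrite within_sym //; rewrite inE in vN.
  apply: (@within_trans _ e 1 1 _ m); first by rewrite within_sym //; apply: within_edge.
  by rewrite -pc; apply: within_edge (link_edge clus cM cr).
apply/exists_inP; exists u => //.
apply: (within_trans (d1 := 3) (d2 := 2)) (to_link _ chu cu) _.
move: vCh; rewrite inE => /andP[/chM[vM vr _] _].
by rewrite lu; exact (link_near clus vM vr).
Qed.

(** * Assigning the clients *)

(** The clients in [A] are served fractionally from their closed neighbourhood [U], so the common
    capacity times the opening of [U] is at least [#|A|]. The hypothesis replaces this opening by
    [w] at distance [d] from [U], hence [d.+1] from [A]. *)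
Lemma round_assignment (R : realFieldType) (T : finType) (e : rel T)
    (L : T -> nat) (k d : nat) (x : T -> T -> R) (y : T -> R) (w : T -> nat) :
  symmetric e -> (forall u v : T, L u = L v) -> softLP1_sol e L k x y ->
  (forall U : {set T}, \sum_(u in U) y u <=
     (\sum_(v | [exists u in U, within e d u v]) w v)%:R) ->
  exists phi : T -> T,
    [/\ forall v, (0 < w (phi v))%N,
        forall v, phi v = v \/ power_edge e d.+1 (phi v) v
      & forall u, (#|[set v | phi v == u]| <= L u * w u)%N].
Proof.
move=> sym Lconst [_ _ cap cover [_ supp x0]] hall.
have nx u v : ~~ within e 1 u v -> x u v = 0.
  by move=> /withinP; apply: supp.
have [A _|phi [phir phic]] := @capacitated_hall T T
  (fun v u => within e d.+1 v u) (fun u => (L u * w u)%N) [set: T].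
  pose U := [set u | [exists v in A, within e 1 u v]].
  have -> : (\sum_(u | [exists v in A, within e d.+1 v u]) L u * w u =
    \sum_(u | [exists u' in U, within e d u' u]) L u * w u)%N.
    apply: eq_bigl => u; apply/exists_inP/exists_inP.
      move=> [v vA] /existsP[u' /andP[vu' u'u]]; exists u' => //.
      rewrite inE; apply/exists_inP; exists v => //; rewrite within_sym //.
      by apply: (within_step (w := u')) => //=.
    move=> [u']; rewrite inE => /exists_inP[v vA u'v] u'u; exists v => //.
    by apply: (within_trans (d1 := 1)) u'u; rewrite within_sym.
  rewrite -(ler_nat R) -sum1_card natr_sum.
  rewrite -(eq_bigr _ (fun v _ => cover v)) exchange_big /=.
  rewrite (bigID (mem U)) /= [X in _ + X]big1 ?addr0; last first.
    move=> u; rewrite inE => /exists_inPn nU; apply: big1 => v vA.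
    exact: nx (nU _ vA).
  (* A vertex [v0] is needed to name the common capacity. *)
  case: (pickP (mem A)) => [v0 _|A0]; last first.
    rewrite big1 ?ler0n // => u _; apply: big1 => v vA.
    by have := A0 v; rewrite /= vA.
  apply: (le_trans (y := \sum_(u in U) (L v0)%:R * y u)).
    apply: ler_sum => u _; rewrite (Lconst v0 u); apply: le_trans (cap u).
    by rewrite [leRHS](bigID (mem A)) /= lerDl sumr_ge0.
  rewrite -mulr_sumr (eq_bigr (fun u => L v0 * w u)%N) => [|u _]; last first.
    by rewrite (Lconst u v0).
  by rewrite -big_distrr natrM ler_wpM2l.
have /fin_all_exists[f fP] v : exists u, phi v = Some u /\ within e d.+1 v u.
  by have [|u] := phir v; [rewrite inE | exists u].
have fc u : (#|[set v | f v == u]| <= L u * w u)%N.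
  apply: leq_trans (phic u); apply: subset_leq_card; apply/subsetP=> v.
  by rewrite !inE => /eqP <-; case: (fP v) => -> _; rewrite eqxx.
exists f; split=> // v.
  (* The fibre over [f v] contains [v], so its bound [L * w] cannot be zero. *)
  have : (0 < #|[set v' | f v' == f v]|)%N.
    by apply/card_gt0P; exists v; rewrite inE.
  by move/leq_trans/(_ (fc _)); rewrite muln_gt0 => /andP[].
have [->|/eqP ne] := eqVneq (f v) v; [by left | right; split=> //].
by apply/withinP; rewrite within_sym //; case: (fP v).
Qed.

(** * From LP solutions to centers *)

Lemma LP1_softLP1 (R : realFieldType) (T : finType) (e : rel T)
    (L : T -> nat) (k : nat) (x : T -> T -> R) (y : T -> R) :
  LP1_sol e L k x y -> softLP1_sol e L k x y.
Proof.
by case=> ? ? ? ? [y01 ? ?]; split=> //; split=> // u; case: (y01 u).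
Qed.

Lemma softLP1_reserve (R : realFieldType) (T : finType) (e : rel T)
    (L : T -> nat) (k : nat) (x : T -> T -> R) (y : T -> R) :
  symmetric e -> connected_graph e -> (0 < k)%N -> softLP1_sol e L k x y ->
  exists M r cl p l rk, clustering e M r cl p l rk /\
    exists rho n z, reserve e M r cl p y k rho n z.
Proof.
move=> sym conn k0 [ysum xy _ cover [y0 supp _]].
(* A root exists because the openings sum to [k], which is positive. *)
have [r _] : exists r : T, true.
  case: (pickP (@predT T)) => [r _|none]; first by exists r.
  by move: k0; rewrite -(ltr_nat R) -ysum big_pred0 ?ltxx.
have [M [cl [p [l [rk clus]]]]] := clustering_exists r sym conn.
exists M, r, cl, p, l, rk; split=> //.
apply: reserve_exists clus y0 ysum _ => m _.
(* The client [m] is served entirely from its closed neighbourhood, with [x u m] at most [y u]. *)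
rewrite -(cover m) [leRHS]big_mkcond; apply: ler_sum => u _.
case: ifPn => // far; rewrite supp // => /withinP um.
by rewrite within_sym // um in far.
Qed.

Theorem theorem7 (R : realFieldType) (T : finType) (e : rel T)
    (L : T -> nat) (k : nat) :
  simple_graph e -> connected_graph e ->
  (forall u v : T, L u = L v) -> (0 < k)%N ->
  (LP1_feasible R e L k -> hard_kcenter (power_edge e 6) L k) /\
  (softLP1_feasible R e L k -> soft_kcenter (power_edge e 5) L k).
Proof.
move=> [sym irr] conn Lconst k0; split=> -[x [y sol]].
  have soft := LP1_softLP1 sol.
  have [M [r [cl [p [l [rk [clus [rho [n [z res]]]]]]]]]] :=
    softLP1_reserve sym conn k0 soft.
  have [|S cS trans] := hard_transfer sym irr _ clus res.
    by case: sol => _ _ _ _ [y01 _ _] u; case: (y01 u).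
  (* Here [w] is the indicator of [S]: its positivity at [phi v] places [phi v] in [S]. *)
  have [phi [pos edge cap]] := round_assignment sym Lconst soft trans.
  exists S, phi; split=> // [|v|u]; first by rewrite cS.
    by have := pos v; case: (phi v \in S).
  by apply: leq_trans (cap u) _; case: (u \in S); rewrite ?muln1 ?muln0.
have [M [r [cl [p [l [rk [clus [rho [n [z res]]]]]]]]]] :=
  softLP1_reserve sym conn k0 sol.
have [phi [pos edge cap]] := round_assignment sym Lconst sol
  (fun U => soft_transfer U sym clus res).
exists (fun v => if v \in M then n v else 0%N), phi; split=> //.
by rewrite -big_mkcond (n_sum res).
Qed.
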